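(* Let $X$ be a sufficiently large positive real number and define $$\Gamma(X)=\sum_{1\leq n\leq X}\mu^2(n^2+1)\,\mu^2(n^2+2),$$ where $n$ runs over positive integers and $\mu$ is the Möbius function. Then for every $\varepsilon>0$, $$\Gamma(X)=\sigma X+O\!\left(X^{\frac{8}{9}+\varepsilon}\right),$$ where the implied constant depends only on $\varepsilon$, and $$\sigma=\prod_{p>2}\left(1-\frac{\left(\frac{-1}{p}\right)+\left(\frac{-2}{p}\right)+2}{p^2}\right),$$ the product being over odd primes $p$.
   Context: $\mu(n)$ denotes the Möbius function, so $\mu^2(m)=1$ if $m$ is square-free and $0$ otherwise. For an odd prime $p$, $\left(\frac{\cdot}{p}\right)$ denotes the Legendre symbol. *)

(* Defs.v *)
From mathcomp Require Import ssreflect ssrfun ssrbool eqtype ssrnat seq div prime.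
From Stdlib Require Import ZArith Reals.

(* Möbius function (as an integer): mu(0) := 0 by convention (never used),
   mu(n) = (-1)^k if n > 0 is a product of k distinct primes, 0 otherwise. *)
Definition mobius (n : nat) : Z :=
  if n == 0 then 0%Z
  else if all (fun p => logn p n <= 1) (primes n)
       then (if odd (size (primes n)) then (-1)%Z else 1%Z)
       else 0%Z.

Definition legendre (a : Z) (p : nat) : Z :=
  if Z.eqb (Z.modulo a (Z.of_nat p)) 0 then 0%Z
  else if has (fun x : nat => Z.eqb (Z.modulo (Z.of_nat x * Z.of_nat x - a) (Z.of_nat p)) 0)
              (iota 0 p)
       then 1%Z else (-1)%Z.

(* Gamma(X) = sum_{1 <= n <= X} mu^2(n^2+1) mu^2(n^2+2).
   For real X, the integers n >= 1 with n <= X are exactly 1, ..., up X - 1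
   (Stdlib's [up X] is the unique integer with X < up X <= X + 1). *)
Definition Gamma (X : R) : R :=
  IZR (foldr Z.add 0%Z
         (map (fun n : nat => (mobius (n * n + 1) ^ 2 * mobius (n * n + 2) ^ 2)%Z)
              (iota 1 (Z.to_nat (up X) - 1)))).

Definition euler_factor (p : nat) : R :=
  (1 - (IZR (legendre (-1) p) + IZR (legendre (-2) p) + 2) / (INR p * INR p))%R.

Definition sigma_partial (N : nat) : R :=
  foldr Rmult 1%R
    (map euler_factor [seq p <- iota 0 N.+1 | prime p && odd p]).

(* Main.v *)
Require Import Defs.
From mathcomp Require Import ssreflect ssrfun ssrbool eqtype ssrnat seq div prime zify.
From Stdlib Require Import ZArith Reals Lra Lia.

(** Write rho(d) for the number of n mod d^2 with d^2 | (n^2+1)(n^2+2); it is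
    multiplicative, and rho(p) = (-1/p) + (-2/p) + 2 for odd p. Let U be about X^(1/18).
    The integers n <= X such that no prime p <= U^2 has p^2 | (n^2+1)(n^2+2) are counted
    by a Buchstab recursion over the primes, truncated at d > U^8; as all primes are at
    most U^2, only d <= U^10 occur, and the error is O(U^15) by Rankin's trick. The
    primes p in (U^2, U^16] exclude at most sum (4 X / p^2 + 4) = O(U^16) further n. If
    p > U^16, then n^2 + c = k p^2 with c in {1, 2} and k = O(U^4), and for fixed k and c
    the solutions satisfy n2^2 >= 2 n1^2, so there are only O(log X) of them. Finally
    the partial product over p <= U^2 differs from sigma by O(U^-2). *)

(** * Counting on initial segments: periodic predicates and the Chinese remainder theorem *)

Lemma count_iotaD (P : pred nat) m n :
  count P (iota 0 (m + n)) = count P (iota 0 m) + count (fun i => P (m + i)) (iota 0 n).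
Proof.
rewrite iotaD count_cat add0n; congr (_ + _).
by rewrite -[X in iota X n]addn0 iotaDl count_map.
Qed.

Lemma leq_count_iota (P : pred nat) m n :
  m <= n -> count P (iota 0 m) <= count P (iota 0 n).
Proof. by move=> /subnKC <-; rewrite count_iotaD leq_addr. Qed.

Lemma count_has_le (I : Type) (T : Type) (P : I -> pred T) (s : seq I) (r : seq T) :
  count (fun x => has (fun i => P i x) s) r <= sumn (map (fun i => count (P i) r) s).
Proof.
elim: s => [|i s IH] /=; first by rewrite count_pred0.
apply: leq_trans (leq_add (leqnn _) IH).
by rewrite -count_predUI; apply: leq_addr.
Qed.

Lemma leq_sumn_map (I : eqType) (f g : I -> nat) (s : seq I) :
  (forall i, i \in s -> f i <= g i) -> sumn (map f s) <= sumn (map g s).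
Proof.
elim: s => [|i s IH] //= H; apply: leq_add; first by apply: H; rewrite mem_head.
by apply: IH => j js; apply: H; rewrite in_cons js orbT.
Qed.

Lemma sumn_map_const (I : Type) (c : nat) (s : seq I) : sumn (map (fun=> c) s) = size s * c.
Proof. by elim: s => [|i s IH] //=; rewrite IH mulSn. Qed.

Section PeriodicCount.

Variables (P : pred nat) (m : nat).
Hypothesis per : forall n, P (m + n) = P n.

Lemma periodicM q n : P (q * m + n) = P n.
Proof. by elim: q => [|q IH] //; rewrite mulSn -addnA per. Qed.

Lemma periodic_modn n : P (n %% m) = P n.
Proof. by rewrite [in RHS](divn_eq n m) periodicM. Qed.

Lemma count_periodicM q : count P (iota 0 (q * m)) = q * count P (iota 0 m).
Proof.
elim: q => [|q IH] //; rewrite !mulSn count_iotaD -IH; congr (_ + _).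
exact: eq_count.
Qed.

Lemma count_periodic_bounds N : 0 < m ->
  N %/ m * count P (iota 0 m) <= count P (iota 0 N) <= (N %/ m).+1 * count P (iota 0 m).
Proof.
move=> m0; rewrite -!count_periodicM !leq_count_iota //.
  by rewrite mulSn addnC {1}(divn_eq N m) leq_add2l ltnW // ltn_mod.
by rewrite {2}(divn_eq N m) leq_addr.
Qed.

(** With c the count over one period and q = [N %/ m], both the count and its expected value lie
    between q c and (q + 1) c. *)
Lemma count_periodic_density N : 0 < m ->
  (Rabs (INR (count P (iota 0 N)) - INR N * (INR (count P (iota 0 m)) / INR m))
     <= INR (count P (iota 0 m)))%R.
Proof.
move=> m0; have /andP[lo hi] := count_periodic_bounds N m0.
have rm : N %% m < m by rewrite ltn_mod.
set c := count P (iota 0 m) in lo hi *; set A := count P (iota 0 N) in lo hi *.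
have eN := divn_eq N m; set q := N %/ m in lo hi eN; set r := N %% m in rm eN.
have m0R : (0 < INR m)%R by apply: lt_0_INR; lia.
have c0R : (0 <= INR c)%R by apply: pos_INR.
have loR : (INR q * INR c <= INR A)%R by rewrite -mult_INR; apply: le_INR; lia.
have hiR : (INR A <= (INR q + 1) * INR c)%R.
  by rewrite -S_INR -mult_INR; apply: le_INR; lia.
have rR : (0 <= INR r <= INR m)%R by split; [apply: pos_INR | apply: le_INR; lia].
have NR : (INR N = INR q * INR m + INR r)%R by rewrite [in LHS]eN plus_INR mult_INR.
have -> : (INR N * (INR c / INR m) = INR q * INR c + INR r / INR m * INR c)%R.
  by rewrite NR; field; lra.
have [x0 x1] : (0 <= INR r / INR m <= 1)%R.
  split; first by apply: Rmult_le_pos; [lra | left; apply: Rinv_0_lt_compat].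
  by apply: (Rmult_le_reg_r (INR m)) => //; field_simplify; lra.
by apply: Rabs_le; split; nra.
Qed.

End PeriodicCount.

Lemma count_allpairs (P Q : pred nat) (s t : seq nat) :
  count (fun u => P u.1 && Q u.2) [seq (x, y) | x <- s, y <- t] = count P s * count Q t.
Proof.
elim: s => [|x s IH] //=.
rewrite count_cat IH mulnDl; congr (_ + _); rewrite count_map /=.
case Px: (P x); first by rewrite mul1n; apply: eq_count => y /=; rewrite Px.
by rewrite mul0n -(count_pred0 t); apply: eq_count => y /=; rewrite Px.
Qed.

(** By the Chinese remainder theorem, n -> (n mod m, n mod k) is a bijection from [0, m k) onto the
    pairs of residues. *)
Lemma count_coprimeM (P Q : pred nat) m k :
  (forall n, P (m + n) = P n) -> (forall n, Q (k + n) = Q n) ->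
  0 < m -> 0 < k -> coprime m k ->
  count (fun n => P n && Q n) (iota 0 (m * k)) = count P (iota 0 m) * count Q (iota 0 k).
Proof.
move=> perP perQ m0 k0 cop.
pose f n := (n %% m, n %% k).
rewrite -count_allpairs (eq_count (a2 := preim f (fun u => P u.1 && Q u.2))); last first.
  by move=> n /=; rewrite !periodic_modn.
rewrite -count_map; apply/permP.
have uf : uniq (map f (iota 0 (m * k))).
  rewrite map_inj_in_uniq ?iota_uniq // => a b; rewrite !mem_iota !add0n /= => al bl [ea eb].
  apply/eqP; rewrite -(modn_small al) -(modn_small bl) chinese_remainder //.
  by rewrite ea eb !eqxx.
apply: uniq_perm => //; first by rewrite allpairs_uniq ?iota_uniq // => -[a b] [c d].
(* Surjectivity comes from counting: a duplicate-free list inside a list of the same length exhausts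
   it. *)
have [] // := uniq_min_size uf (s2 := [seq (x, y) | x <- iota 0 m, y <- iota 0 k]).
- move=> u /mapP[n nl ->]; apply/allpairsP; exists (f n); split => //=;
  by rewrite mem_iota add0n ltn_mod.
- by rewrite size_map size_allpairs !size_iota.
Qed.

(** * Divisibility of (n^2+1)(n^2+2) by squares of primes *)

(** As the two factors are coprime, p^2 divides the product only if it divides one of them, so one
    polynomial carries both squarefreeness conditions. *)
Definition quart n := (n * n + 1) * (n * n + 2).

Lemma dvdn_sqD d c n : (d %| (d + n) * (d + n) + c) = (d %| n * n + c).
Proof.
have -> : (d + n) * (d + n) + c = d * (d + 2 * n) + (n * n + c) by lia.
by rewrite dvdn_addr // dvdn_mulr.
Qed.

Lemma coprime_sqD n : coprime (n * n + 1) (n * n + 2).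
Proof. by have -> : n * n + 2 = (n * n + 1).+1; [lia | rewrite coprimenS]. Qed.

Lemma prime_sq_dvd_quart p n : prime p ->
  (p * p %| quart n) = (p * p %| n * n + 1) || (p * p %| n * n + 2).
Proof.
move=> pp; apply/idP/orP => [H|[H|H]]; last 2 first.
- by rewrite dvdn_mulr.
- by rewrite dvdn_mull.
have [p1|np1] := boolP (p %| n * n + 1).
  left; rewrite -(@Gauss_dvdl _ _ (n * n + 2)) // coprimeMl andbb.
  by apply: coprime_dvdl p1 (coprime_sqD n).
by right; rewrite -(@Gauss_dvdr _ (n * n + 1)) // coprimeMl andbb prime_coprime.
Qed.

(** * Roots of n^2 + c modulo p^2 for odd p *)

Section LocalCount.

Variables (p c : nat).
Hypotheses (pp : prime p) (op : odd p) (pc : ~~ (p %| c)).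

(** Hensel lifting: a root a mod p is corrected to a + p t, and the linear congruence for t is
    solvable because p does not divide 2 a. *)
Lemma sqrt_lift a : p %| a * a + c -> exists b, (b < p * p) && (p * p %| b * b + c).
Proof.
move=> /dvdnP[s es].
have p0 := prime_gt0 pp.
have npa : ~~ (p %| a).
  by apply: contra pc => pa; rewrite -(dvdn_addr c (dvdn_mulr a pa)) es dvdn_mull.
have cop : coprime p (2 * a).
  by rewrite prime_coprime // Euclid_dvdM // negb_or npa andbT (@dvdn_prime2 p 2) //; case: eqP op => // ->.
have [u eu] : exists u, 2 * a * u = 1 %[mod p].
  (* A number that is 1 mod p and 0 mod 2 a, divided by 2 a, inverts 2 a mod p. *)
  exists (chinese p (2 * a) 1 0 %/ (2 * a)).
  have d2 : 2 * a %| chinese p (2 * a) 1 0 by rewrite /dvdn chinese_modr // mod0n.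
  by rewrite mulnC divnK // chinese_modl.
(* This solves s + 2 a t = 0 mod p; the factor p - 1 stands for -1 in the natural numbers. *)
pose t := s * (p - 1) * u.
exists ((a + p * t) %% (p * p)); rewrite ltn_mod muln_gt0 p0 /=.
rewrite (periodic_modn (fun x => p * p %| x * x + c)); last by move=> n; apply: dvdn_sqD.
have -> : (a + p * t) * (a + p * t) + c = p * (s + 2 * a * t) + p * p * (t * t) by lia.
rewrite dvdn_addl; last exact: dvdn_mulr.
rewrite dvdn_pmul2l //.
have -> : 2 * a * t = s * (p - 1) * (2 * a * u) by rewrite /t; lia.
rewrite /dvdn -modnDmr -modnMmr eu modnMmr modnDmr muln1.
have -> : s + s * (p - 1) = s * p by nia.
by rewrite modnMl.
Qed.

(** The roots are b and p^2 - b: for any root n, p^2 divides (n - b)(n + b), and p cannot divide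
    both factors since it does not divide 2 b. *)
Lemma count_two_sqrt b : b < p * p -> p * p %| b * b + c ->
  count (fun n => p * p %| n * n + c) (iota 0 (p * p)) = 2.
Proof.
move=> bl bd; have p0 := prime_gt0 pp.
have pdvd x : p * p %| x -> p %| x by apply: dvdn_trans; apply: dvdn_mulr.
have npb : ~~ (p %| b).
  apply: contra pc => pb; rewrite -(dvdn_addr c (dvdn_mulr b pb)); exact: pdvd.
have b0 : 0 < b by case: (b) npb => //; rewrite dvdn0.
have np2 : ~~ (p %| 2) by rewrite (@dvdn_prime2 p 2) //; case: eqP op => // ->.
have split2 x y : p * p %| x * y -> ~~ ((p %| x) && (p %| y)) ->
    (p * p %| x) || (p * p %| y).
  move=> H; rewrite negb_and => /orP[px|py]; apply/orP; [right|left].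
    by rewrite -(@Gauss_dvdr _ x) // coprimeMl andbb prime_coprime.
  by rewrite -(@Gauss_dvdl _ _ y) // coprimeMl andbb prime_coprime.
have small x : x < p * p -> p * p %| x -> x = 0.
  by case: x => // x xl /dvdn_leq; lia.
rewrite -size_filter; apply: (@perm_size _ _ [:: b; p * p - b]).
apply: uniq_perm; first by rewrite filter_uniq ?iota_uniq.
  rewrite /= in_cons in_nil orbF andbT; apply/eqP => e.
  have e2 : p * p = b + b by move: e bl; clear; lia.
  have : odd (p * p) by rewrite oddM op.
  by rewrite e2 addnn odd_double.
move=> n; rewrite mem_filter mem_iota add0n !in_cons in_nil orbF /=.
apply/andP/orP => [[nd nl]|[/eqP->|/eqP->]]; last 2 first.
- by split.
- split; last by move: bl b0; clear; lia.
  have e : p * p * (2 * b) + ((p * p - b) * (p * p - b) + c) = p * p * (p * p) + (b * b + c).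
    by move: (p * p) bl => m bl; have -> : m = b + (m - b) by [lia]; nia.
  by rewrite -(dvdn_addr _ (dvdn_mulr (2 * b) (dvdnn (p * p)))) e dvdn_addr // dvdn_mulr.
(* With truncated subtraction, x - y + (y - x) is |x - y|, which treats both orders of n and b at
   once. *)
have diff x y : y <= x -> x * x + c = (x - y + (y - x)) * (x + y) + (y * y + c).
  move=> /subnKC <-; move: (x - y) => k.
  by rewrite addKn subnDA subnn sub0n addn0; clear; lia.
have prodd : p * p %| (n - b + (b - n)) * (n + b).
  case: (leqP b n) => [/diff e|/ltnW/diff e]; first by rewrite -(dvdn_addl _ bd) -e.
  by rewrite -(dvdn_addl _ nd) addnC -[n + b]addnC [n - b + _]addnC addnC -e.
have /orP[/small H|d2] : (p * p %| n - b + (b - n)) || (p * p %| n + b).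
- apply: split2 prodd _; apply/andP => -[d1 d2]; have : p %| 2 * b; last by rewrite Euclid_dvdM // (negbTE np2) (negbTE npb).
  case: (leqP b n) => bn.
    rewrite -(dvdn_addr _ d1).
    by have -> : n - b + (b - n) + 2 * b = n + b by move: bn; clear; lia.
  have -> : 2 * b = n - b + (b - n) + (n + b) by move: bn; clear; lia.
  exact: dvdn_add.
- left; apply/eqP; have : n - b + (b - n) = 0 by apply: H; move: bl nl; clear; lia.
  by clear; lia.
case: (ltnP (n + b) (p * p)) => H; first by have := small _ H d2; move: b0; clear; lia.
right; have : p * p %| n + b - p * p by rewrite dvdn_subr.
move=> /small e; apply/eqP; have : n + b - p * p = 0 by apply: e; move: bl nl; clear; lia.
by move: H; clear; lia.
Qed.

(** The symbol is not 0 as p does not divide c. A root mod p lifts to mod p^2, where there are then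
    exactly two; a root mod p^2 reduces to one mod p. *)
Lemma count_sqrt_legendre :
  Z.of_nat (count (fun n => p * p %| n * n + c) (iota 0 (p * p))) =
  (1 + legendre (- Z.of_nat c) p)%Z.
Proof.
have p0 := prime_gt0 pp.
have pdvd x : p * p %| x -> p %| x by apply: dvdn_trans; apply: dvdn_mulr.
have dvdZ x : reflect (Z.modulo (Z.of_nat x) (Z.of_nat p) = 0%Z) (p %| x).
  apply: (iffP idP) => [/dvdnP[k ->]|].
    by rewrite Nat2Z.inj_mul Z.mod_mul //; lia.
  by move=> /Z.mod_divide H; have [|k e] := H _; [lia|apply/dvdnP; exists (Z.to_nat k); nia].
have E1 : Z.eqb (Z.modulo (- Z.of_nat c) (Z.of_nat p)) 0 = false.
  apply/Z.eqb_neq => H; move/dvdZ: pc; apply; apply/Z.mod_divide; first lia.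
  by apply/Z.divide_opp_r/Z.mod_divide => //; lia.
rewrite /legendre E1.
have E2 x : Z.eqb (Z.modulo (Z.of_nat x * Z.of_nat x - - Z.of_nat c) (Z.of_nat p)) 0 = (p %| x * x + c).
  have -> : (Z.of_nat x * Z.of_nat x - - Z.of_nat c = Z.of_nat (x * x + c))%Z by lia.
  by apply/idP/dvdZ => [/Z.eqb_eq|/Z.eqb_eq].
rewrite (eq_has E2); case: hasP => [[x _ px]|nh].
  by have [b /andP[bl bd]] := sqrt_lift _ px; rewrite (count_two_sqrt b).
suff -> : count (fun n => p * p %| n * n + c) (iota 0 (p * p)) = 0 by [].
apply/eqP; rewrite -leqn0 leqNgt -has_count; apply/hasP => -[x _ /pdvd px].
apply: nh; exists (x %% p); first by rewrite mem_iota add0n ltn_mod.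
by rewrite (periodic_modn (fun x => p %| x * x + c)) // => n; apply: dvdn_sqD.
Qed.

Lemma count_sqrt_le2 : count (fun n => p * p %| n * n + c) (iota 0 (p * p)) <= 2.
Proof.
have := count_sqrt_legendre; rewrite /legendre; case: Z.eqb; last case: has; lia.
Qed.

End LocalCount.

(** * The multiplicative function [rho] and its values at odd primes *)

Definition rho d := count (fun n => d * d %| quart n) (iota 0 (d * d)).

Lemma dvdn_quartD d n : (d %| quart (d + n)) = (d %| quart n).
Proof.
(* With a = n^2 + 1 and e = d (d + 2 n), this is (a + e)(a + e + 1) - a (a + 1) = e (2 a + 1 +
   e). *)
have -> : quart (d + n) = d * ((d + 2 * n) * (2 * (n * n + 1) + 1 + d * (d + 2 * n))) + quart n by rewrite /quart; nia.
by rewrite dvdn_addr // dvdn_mulr.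
Qed.

Lemma rho1 : rho 1 = 1.
Proof. by []. Qed.

Lemma dvdn_sqM_coprime d p m : coprime d p ->
  (d * p * (d * p) %| m) = (d * d %| m) && (p * p %| m).
Proof.
move=> cop; have -> : d * p * (d * p) = d * d * (p * p) by lia.
by rewrite Gauss_dvd // !coprimeMl !coprimeMr cop.
Qed.

Lemma rhoM d p : 0 < d -> 0 < p -> coprime d p -> rho (d * p) = rho d * rho p.
Proof.
move=> d0 p0 cop; have E : d * p * (d * p) = d * d * (p * p) by lia.
rewrite /rho E -(eq_count (a1 := fun n => (d * d %| quart n) && (p * p %| quart n))); last first.
  by move=> n; rewrite -dvdn_sqM_coprime // E.
apply: count_coprimeM; rewrite ?muln_gt0 ?d0 ?p0 //; try by move=> n; apply: dvdn_quartD.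
by rewrite !coprimeMl !coprimeMr cop.
Qed.

Lemma odd_prime_ndvd p c : prime p -> odd p -> 0 < c <= 2 -> ~~ (p %| c).
Proof.
move=> pp op /andP[c0 c2]; have p1 := prime_gt1 pp.
by apply/negP => /(dvdn_leq c0) pc; have e : p = 2 by [lia]; move: op; rewrite e.
Qed.

Lemma rho_split p : prime p -> rho p =
  count (fun n => p * p %| n * n + 1) (iota 0 (p * p)) +
  count (fun n => p * p %| n * n + 2) (iota 0 (p * p)).
Proof.
move=> pp; rewrite /rho (eq_count (fun n => prime_sq_dvd_quart p n pp)).
rewrite -[RHS]count_predUI [X in _ = _ + X](eq_count (a2 := pred0)) ?count_pred0 ?addn0 //.
move=> n /=; apply/andP => -[d1 d2].
have : p * p %| 1 by rewrite -(eqP (coprime_sqD n)) dvdn_gcd d1.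
by rewrite dvdn1 muln_eq1; case: (p) pp => [|[]].
Qed.

Lemma rho_legendre p : prime p -> odd p ->
  INR (rho p) = (IZR (legendre (-1) p) + IZR (legendre (-2) p) + 2)%R.
Proof.
move=> pp op; rewrite rho_split // plus_INR !INR_IZR_INZ.
rewrite (count_sqrt_legendre p 1) ?odd_prime_ndvd // (count_sqrt_legendre p 2) ?odd_prime_ndvd //.
by rewrite !plus_IZR /=; lra.
Qed.

Lemma rho_le4 p : prime p -> odd p -> rho p <= 4.
Proof.
move=> pp op; rewrite rho_split //.
by apply: (@leq_add _ _ 2 2); apply: count_sqrt_le2 => //; apply: odd_prime_ndvd.
Qed.

(** * The truncated Buchstab sieve with Rankin weights *)

Lemma Rabs_le_inv (a b : R) : (Rabs a <= b)%R -> (- b <= a <= b)%R.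
Proof. by move=> H; have := Rle_abs a; have := Rle_abs (- a); rewrite Rabs_Ropp; lra. Qed.

Definition sieved (ps : seq nat) n := all (fun p => ~~ (p * p %| quart n)) ps.

Definition sieve_count N ps d :=
  count (fun n => (d * d %| quart n) && sieved ps n) (iota 0 N).

Definition sq_density d : R := (INR (rho d) / (INR d * INR d))%R.

(* Rankin's trick: [rho d / d^2] for large [d] and [rho d] for small [d] are both
   compared with the multiplicative, summable weight [rho d / d^(3/2)]. *)
Definition rankin d : R := (INR (rho d) / (INR d * sqrt (INR d)))%R.

Definition density_prod (ps : seq nat) : R :=
  foldr Rmult 1%R (map (fun p => 1 - sq_density p)%R ps).

(** Since [rho p] is at most 4 at odd primes, this majorises the product of 1 + [rankin p], the
    total weight of the divisors met in the recursion. *)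
Definition rankin_prod (ps : seq nat) : R :=
  foldr Rmult 1%R (map (fun p => 1 + 4 / (INR p * sqrt (INR p)))%R ps).

(** Buchstab's identity: the n that survive [ps] are sorted by whether p^2 divides [quart n]. *)
Lemma sieve_count_cons N p ps d : coprime d p ->
  sieve_count N ps d = sieve_count N (p :: ps) d + sieve_count N ps (d * p).
Proof.
move=> cop; rewrite /sieve_count -[RHS]count_predUI.
rewrite [X in _ = _ + X](eq_count (a2 := pred0)) ?count_pred0 ?addn0; last first.
  by move=> n /=; rewrite dvdn_sqM_coprime //; case: (p * p %| _); rewrite ?andbF.
apply: eq_count => n /=; rewrite dvdn_sqM_coprime //.
by case: (p * p %| _); case: (d * d %| _); case: (sieved _ _).
Qed.

Lemma sieve_count_le N ps d : sieve_count N ps d <= sieve_count N [::] d.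
Proof. by apply: sub_count => n /=; case: (d * d %| _). Qed.

Lemma sieve_count_nil N d : 0 < d ->
  (Rabs (INR (sieve_count N [::] d) - INR N * sq_density d) <= INR (rho d))%R.
Proof.
move=> d0; rewrite /sieve_count (eq_count (a2 := fun n => d * d %| quart n)); last first.
  by move=> n /=; rewrite andbT.
rewrite /sq_density -mult_INR; apply: count_periodic_density; last by rewrite muln_gt0 d0.
by move=> n; apply: dvdn_quartD.
Qed.

Lemma rho_le_sq d : rho d <= d * d.
Proof. by rewrite /rho -[X in _ <= X](size_iota 0); apply: count_size. Qed.

Lemma sq_density_itv d : 0 < d -> (0 <= sq_density d <= 1)%R.
Proof.
move=> d0; have dR : (0 < INR d)%R by apply: lt_0_INR; lia.
have dd : (0 < INR d * INR d)%R by nra.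
have := le_INR _ _ (leP (rho_le_sq d)); rewrite mult_INR => H.
have ? := pos_INR (rho d); have ? := Rinv_0_lt_compat _ dd.
split; first by apply: Rmult_le_pos; lra.
apply: (Rmult_le_reg_r (INR d * INR d)) => //; rewrite /sq_density; field_simplify; lra.
Qed.

Lemma density_prod_itv ps : all (leq 1) ps -> (0 <= density_prod ps <= 1)%R.
Proof.
elim: ps => [|p ps IH] /=; first by rewrite /density_prod /=; lra.
move=> /andP[/sq_density_itv p0 /IH]; rewrite /density_prod /=; nra.
Qed.

Lemma sq_densityM d p : 0 < d -> 0 < p -> coprime d p ->
  sq_density (d * p) = (sq_density d * sq_density p)%R.
Proof.
move=> d0 p0 cop; rewrite /sq_density rhoM // !mult_INR.
have dR : (0 < INR d)%R by apply: lt_0_INR; lia.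
have pR : (0 < INR p)%R by apply: lt_0_INR; lia.
by field; lra.
Qed.

Lemma rankin_ge0 d : 0 < d -> (0 <= rankin d)%R.
Proof.
move=> d0; have dR : (0 < INR d)%R by apply: lt_0_INR; lia.
have ? := sqrt_lt_R0 _ dR.
apply: Rmult_le_pos; first exact: pos_INR.
by left; apply/Rinv_0_lt_compat/Rmult_lt_0_compat.
Qed.

Lemma rankinM_le d p : 0 < d -> 0 < p -> coprime d p -> rho p <= 4 ->
  (rankin (d * p) <= rankin d * (4 / (INR p * sqrt (INR p))))%R.
Proof.
move=> d0 p0 cop r4.
have dR : (0 < INR d)%R by apply: lt_0_INR; lia.
have pR : (0 < INR p)%R by apply: lt_0_INR; lia.
have sd := sqrt_lt_R0 _ dR; have sp := sqrt_lt_R0 _ pR.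
have -> : rankin (d * p) = (rankin d * (INR (rho p) / (INR p * sqrt (INR p))))%R.
  by rewrite /rankin rhoM // !mult_INR sqrt_mult_alt; [field; lra | lra].
apply: Rmult_le_compat_l; first exact: rankin_ge0.
apply: Rmult_le_compat_r; first by left; apply/Rinv_0_lt_compat/Rmult_lt_0_compat.
by have := le_INR _ _ (leP r4); rewrite [INR 4]/=; lra.
Qed.

Lemma rankin_prod_ge1 ps : all (leq 1) ps -> (1 <= rankin_prod ps)%R.
Proof.
elim: ps => [|p ps IH] /=; first by rewrite /rankin_prod /=; lra.
move=> /andP[p0 /IH]; rewrite /rankin_prod /= => H.
have pR : (0 < INR p)%R by apply: lt_0_INR; lia.
have sp := sqrt_lt_R0 _ pR.
have : (0 <= 4 / (INR p * sqrt (INR p)))%R.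
  by apply: Rmult_le_pos; [lra | left; apply/Rinv_0_lt_compat/Rmult_lt_0_compat].
by nra.
Qed.

(** The density is [rankin d] divided by the square root of d, which is at least that of z. *)
Lemma sq_density_rankin d z : 0 < d -> (0 < z <= INR d)%R ->
  (sq_density d <= / sqrt z * rankin d)%R.
Proof.
move=> d0 [z0 zd]; have dR : (0 < INR d)%R by apply: lt_0_INR; lia.
have sd := sqrt_lt_R0 _ dR; have sz := sqrt_lt_R0 _ z0.
have -> : sq_density d = (/ sqrt (INR d) * rankin d)%R.
  rewrite /sq_density /rankin -{2}(sqrt_sqrt (INR d)); last lra.
  by field; lra.
apply: Rmult_le_compat_r; first exact: rankin_ge0.
by apply: Rinv_le_contravar => //; apply: sqrt_le_1_alt.
Qed.

Lemma rho_rankin d D : 0 < d -> (INR d <= D)%R -> (INR (rho d) <= D * sqrt D * rankin d)%R.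
Proof.
move=> d0 dD; have dR : (0 < INR d)%R by apply: lt_0_INR; lia.
have sd := sqrt_lt_R0 _ dR; have sD := sqrt_le_1_alt _ _ dD.
have e : INR (rho d) = (INR d * sqrt (INR d) * rankin d)%R by rewrite /rankin; field; lra.
by rewrite {1}e; apply: Rmult_le_compat_r; [exact: rankin_ge0 | nra].
Qed.

(* Buchstab's recursion S(p :: ps, d) = S(ps, d) - S(ps, d p) is only unfolded while
   d <= z; beyond that both the count and its expected value are small. *)
Lemma sieve_count_approx (N : nat) (z w D : R) (ps : seq nat) d :
  (0 < z)%R -> (z * w <= D)%R ->
  (forall p, p \in ps -> [/\ prime p, odd p & (INR p <= w)%R]) -> uniq ps ->
  0 < d -> (forall p, p \in ps -> coprime d p) -> (INR d <= D)%R ->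
  (Rabs (INR (sieve_count N ps d) - INR N * sq_density d * density_prod ps)
     <= (INR N / sqrt z + D * sqrt D) * rankin d * rankin_prod ps)%R.
Proof.
move=> z0 zwD; elim: ps d => [|p ps IH] d Pps ups d0 copd dD.
  rewrite /density_prod /rankin_prod /= !Rmult_1_r.
  have := sieve_count_nil N _ d0; have := rho_rankin _ _ d0 dD; have R0 := rankin_ge0 _ d0.
  have Nz : (0 <= INR N / sqrt z)%R.
    by apply: Rmult_le_pos; [exact: pos_INR | left; apply/Rinv_0_lt_compat/sqrt_lt_R0].
  by have := Rmult_le_pos _ _ Nz R0; lra.
have ge1 : all (leq 1) (p :: ps) by apply/allP => q /Pps[/prime_gt0].
(* When d > z, the count lies in [0, N g + [rho d]] and the main term in [0, N g], where g =
   [sq_density d]; Rankin's trick bounds N g and [rho d]. *)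
have [dz|zd] := Rle_or_lt (INR d) z; last first.
  have := sq_density_rankin _ _ d0 (conj z0 (Rlt_le _ _ zd)).
  have := rho_rankin _ _ d0 dD.
  have := le_INR _ _ (leP (sieve_count_le N (p :: ps) d)).
  have [G0 G1] := density_prod_itv _ ge1; have K1 := rankin_prod_ge1 _ ge1.
  have R0 := rankin_ge0 _ d0; have [g0 _] := sq_density_itv _ d0.
  have S0 := pos_INR (sieve_count N (p :: ps) d); have N0 := pos_INR N.
  have /Rabs_le_inv[_ S1] := sieve_count_nil N _ d0.
  move=> H1 H2 H3.
  have H4 : (INR N * sq_density d <= INR N / sqrt z * rankin d)%R.
    by rewrite /Rdiv Rmult_assoc; apply: Rmult_le_compat_l.
  have H5 : (0 <= INR N * sq_density d)%R by apply: Rmult_le_pos.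
  have H6 : (0 <= INR N * sq_density d * density_prod (p :: ps) <= INR N * sq_density d)%R by nra.
  have H7 := pos_INR (rho d).
  apply: (Rle_trans _ (INR N * sq_density d + INR (rho d))); first by apply: Rabs_le; lra.
  apply: (Rle_trans _ ((INR N / sqrt z + D * sqrt D) * rankin d)); first lra.
  rewrite -[X in (X <= _)%R]Rmult_1_r; apply: Rmult_le_compat_l => //; lra.
have [pp op pw] := Pps _ (mem_head _ _).
have p0 := prime_gt0 pp; have cdp := copd _ (mem_head _ _).
move: ups => /= /andP[npps ups].
have Pps' q : q \in ps -> [/\ prime q, odd q & (INR q <= w)%R].
  by move=> qps; apply: Pps; rewrite in_cons qps orbT.
have copd' q : q \in ps -> coprime d q by move=> qps; apply: copd; rewrite in_cons qps orbT.
have copdp q : q \in ps -> coprime (d * p) q.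
  move=> qps; rewrite coprimeMl copd' //= prime_coprime // dvdn_prime2 //; last by case: (Pps' _ qps).
  by apply: contraNneq npps => ->.
(* Here d <= z and p <= w, so the new divisor still obeys d p <= z w <= D. *)
have dpD : (INR (d * p) <= D)%R.
  rewrite mult_INR; apply: Rle_trans zwD.
  by apply: Rmult_le_compat => //; apply: pos_INR.
have dp0 : 0 < d * p by rewrite muln_gt0 d0.
have A1 := IH d Pps' ups d0 copd' dD.
have A2 := IH (d * p) Pps' ups dp0 copdp dpD.
have A3 := rankinM_le _ _ d0 p0 cdp (rho_le4 _ pp op).
have eS : INR (sieve_count N (p :: ps) d) = (INR (sieve_count N ps d) - INR (sieve_count N ps (d * p)))%R.
  by have /(f_equal INR) := sieve_count_cons N p ps d cdp; rewrite plus_INR => ->; lra.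
rewrite sq_densityM // in A2.
have K1 := rankin_prod_ge1 ps; have {}K1 := K1 (proj2 (andP ge1)).
have E0 : (0 <= INR N / sqrt z + D * sqrt D)%R.
  apply: Rplus_le_le_0_compat; apply: Rmult_le_pos.
  - exact: pos_INR.
  - by left; apply/Rinv_0_lt_compat/sqrt_lt_R0.
  - by have := pos_INR d; lra.
  - exact: sqrt_pos.
rewrite eS {1}/density_prod /= -/(density_prod ps) {1}/rankin_prod /= -/(rankin_prod ps).
set E := (INR N / sqrt z + D * sqrt D)%R in A1 A2 E0 *.
set r := (4 / (INR p * sqrt (INR p)))%R in A3 *.
(* The errors of the two branches add up to the factor 1 + r, which is the factor of p in
   [rankin_prod]. *)
have A4 : (E * rankin (d * p) * rankin_prod ps <= E * (rankin d * r) * rankin_prod ps)%R.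
  by apply: Rmult_le_compat_r; [lra | apply: Rmult_le_compat_l].
move: A1 A2 => /Rabs_le_inv[a1 a2] /Rabs_le_inv[b1 b2].
by apply: Rabs_le; split; lra.
Qed.

(** * Convergence of the Euler product, with its rate *)

Definition odd_primes M := [seq p <- iota 0 M.+1 | prime p && odd p].

Lemma mem_odd_primes p M : (p \in odd_primes M) = [&& prime p, odd p & p <= M].
Proof. by rewrite mem_filter mem_iota add0n ltnS -andbA. Qed.

Lemma foldr_Rmult_rcons (s : seq R) x :
  foldr Rmult 1%R (rcons s x) = (foldr Rmult 1 s * x)%R.
Proof. by elim: s => [|y s IH] /=; [lra | rewrite IH; lra]. Qed.

Lemma prod_odd_primesS (f : nat -> R) M :
  foldr Rmult 1%R (map f (odd_primes M.+1)) =
  (foldr Rmult 1 (map f (odd_primes M)) *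
     (if prime M.+1 && odd M.+1 then f M.+1 else 1))%R.
Proof.
rewrite /odd_primes -[in LHS](addn1 M.+1) iotaD add0n filter_cat map_cat [iota M.+1 1]/=.
rewrite [[seq p <- [:: M.+1] | _]]/=.
by case: ifP => _; rewrite ?cats0 ?cats1 ?foldr_Rmult_rcons // Rmult_1_r.
Qed.

Lemma sigma_partialE M : sigma_partial M = density_prod (odd_primes M).
Proof.
rewrite /sigma_partial /density_prod -/(odd_primes M); congr foldr.
apply/eq_in_map => p; rewrite mem_odd_primes => /and3P[pp op _].
by rewrite /euler_factor /sq_density rho_legendre.
Qed.

Lemma sigma_partialS_bounds M : 0 < M ->
  (sigma_partial M - 4 / (INR M.+1 * INR M.+1) <= sigma_partial M.+1 <= sigma_partial M)%R.
Proof.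
move=> M0; rewrite !sigma_partialE.
have := prod_odd_primesS (fun p => 1 - sq_density p)%R M.
rewrite -/(density_prod _) -/(density_prod _) => ->.
have [G0 G1] : (0 <= density_prod (odd_primes M) <= 1)%R.
  by apply: density_prod_itv; apply/allP => q; rewrite mem_odd_primes => /and3P[/prime_gt0].
have MR : (0 < INR M.+1)%R by apply: lt_0_INR; lia.
have MM : (0 < / (INR M.+1 * INR M.+1))%R by apply: Rinv_0_lt_compat; nra.
case: ifP => [/andP[pM oM]|_]; last by split; nra.
have [g0 _] := sq_density_itv M.+1 isT.
have g4 : (sq_density M.+1 <= 4 / (INR M.+1 * INR M.+1))%R.
  apply: Rmult_le_compat_r; first lra.
  by have := le_INR _ _ (leP (rho_le4 _ pM oM)); rewrite [INR 4]/=; lra.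
by split; nra.
Qed.

Lemma sigma_partial_itv M : (0 <= sigma_partial M <= 1)%R.
Proof.
rewrite sigma_partialE; apply: density_prod_itv.
by apply/allP => q; rewrite mem_odd_primes => /and3P[/prime_gt0].
Qed.

(** The partial products decrease and are nonnegative, so they converge. The rate holds because
    [sigma_partial M] - 4/M is nondecreasing, as 4/(M+1)^2 <= 4/M - 4/(M+1). *)
Lemma sigma_partial_cv :
  {s : R | Un_cv sigma_partial s &
           forall M, 0 < M -> (s <= sigma_partial M <= s + 4 / INR M)%R}.
Proof.
have dec n : 0 < n -> (sigma_partial n.+1 <= sigma_partial n)%R.
  by move=> n0; have [] := sigma_partialS_bounds _ n0.
have dec' : Un_decreasing sigma_partial.
  (* The products up to 0 and up to 1 are both empty. *)
  move=> [|n]; last exact: dec.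
  by rewrite /sigma_partial /=; lra.
have lb : has_lb sigma_partial.
  exists 0%R => x [n ->]; rewrite /opp_seq.
  by have [] := sigma_partial_itv n; lra.
have [s cvs] := decreasing_cv _ dec' lb; exists s => // M M0; split.
  exact: decreasing_ineq.
pose V k := (sigma_partial (M + k) - 4 / INR (M + k))%R.
have VS k : (V 0%nat <= V k)%R.
  elim: k => [|k IH]; first lra.
  apply: Rle_trans IH _; rewrite /V addnS.
  have [|+ _] := sigma_partialS_bounds (M + k); first lia.
  move: (M + k) (leq_trans M0 (leq_addr k M)) => m m0.
  have mR : (0 < INR m)%R by apply: lt_0_INR; lia.
  rewrite S_INR.
  have -> : (4 / INR m = 4 / (INR m + 1) + 4 / ((INR m + 1) * (INR m + 1)) + 4 / (INR m * (INR m + 1) * (INR m + 1)))%R.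
    by field; lra.
  have : (0 < 4 / (INR m * (INR m + 1) * (INR m + 1)))%R.
    by apply: Rmult_lt_0_compat; [lra | apply: Rinv_0_lt_compat; nra].
  by lra.
(* Otherwise V 0 > s, and all later partial products exceed V 0, contradicting convergence to s. *)
have [//|lt] := Rle_or_lt (sigma_partial M) (s + 4 / INR M).
have [k0 Hk] := cvs (sigma_partial M - (s + 4 / INR M))%R ltac:(lra).
have := Hk (M + k0)%nat ltac:(lia); rewrite /Rdist => /Rabs_def2[+ _].
have := VS k0; rewrite /V addn0.
have : (0 < 4 / INR (M + k0))%R.
  by apply: Rmult_lt_0_compat; [lra | apply/Rinv_0_lt_compat/lt_0_INR; lia].
by lra.
Qed.

(** * A uniform bound for the Rankin product *)

(** Comparison of 4 t^(-3/2) with its integral, whose antiderivative is -8 t^(-1/2). *)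
Lemma inv_sqrt_telescope (n : nat) : 0 < n ->
  (4 / (INR n.+1 * sqrt (INR n.+1)) <= 8 / sqrt (INR n) - 8 / sqrt (INR n.+1))%R.
Proof.
move=> n0; have nR : (0 < INR n)%R by apply: lt_0_INR; lia.
have nR' : (0 < INR n.+1)%R by apply: lt_0_INR; lia.
have e : (INR n.+1 = INR n + 1)%R by rewrite S_INR.
have a0 := sqrt_lt_R0 _ nR; have b0 := sqrt_lt_R0 _ nR'.
have ea := sqrt_sqrt _ (Rlt_le _ _ nR); have eb := sqrt_sqrt _ (Rlt_le _ _ nR').
rewrite -{1}eb; move: (sqrt (INR n)) (sqrt (INR n.+1)) a0 b0 ea eb => a b a0 b0 ea eb.
have ab : (b * b = a * a + 1)%R by lra.
have lt : (a < b)%R by nra.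
(* It remains to see 2 (b - a) b^2 >= a; multiplied by b + a, with b^2 - a^2 = 1, this is 2 b^2 >= a
   (a + b). *)
have -> : (8 / a - 8 / b = 4 / (b * b * b) * (2 * (b - a) * (b * b) / a))%R by field; lra.
rewrite -[X in (X <= _)%R]Rmult_1_r; apply: Rmult_le_compat_l.
  by left; apply: Rmult_lt_0_compat; [lra | apply: Rinv_0_lt_compat; nra].
apply: (Rmult_le_reg_r a) => //; rewrite /Rdiv (Rmult_assoc (2 * (b - a) * (b * b))) Rinv_l; last lra.
apply: (Rmult_le_reg_r (b + a)); first lra.
have -> : (2 * (b - a) * (b * b) * 1 * (b + a) = 2 * (b * b - a * a) * (b * b))%R by ring.
by nra.
Qed.

(** Each factor satisfies 1 + t <= exp t and the exponents telescope; at M = 1 the product is empty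
    and the exponent is 0. *)
Lemma rankin_prod_le M : 0 < M -> (rankin_prod (odd_primes M) <= exp (8 - 8 / sqrt (INR M)))%R.
Proof.
case: M => // M _; elim: M => [|M IH].
  rewrite /rankin_prod /= sqrt_1; have -> : (8 - 8 / 1 = 0)%R by field.
  by rewrite exp_0; lra.
rewrite /rankin_prod prod_odd_primesS -/(rankin_prod _).
have tel := inv_sqrt_telescope M.+1 isT.
have -> : (8 - 8 / sqrt (INR M.+2) = (8 - 8 / sqrt (INR M.+1)) + (8 / sqrt (INR M.+1) - 8 / sqrt (INR M.+2)))%R by lra.
have nR : (0 < INR M.+2)%R by apply: lt_0_INR; lia.
have sn := sqrt_lt_R0 _ nR.
have f0 : (0 < 4 / (INR M.+2 * sqrt (INR M.+2)))%R.
  by apply: Rmult_lt_0_compat; [lra | apply: Rinv_0_lt_compat; nra].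
rewrite exp_plus; apply: Rmult_le_compat => //.
- suff : (1 <= rankin_prod (odd_primes M.+1))%R by lra.
  by apply: rankin_prod_ge1; apply/allP => q; rewrite mem_odd_primes => /and3P[/prime_gt0].
- by case: ifP => _; lra.
apply: Rle_trans (exp_ineq1_le _).
by case: ifP => _; lra.
Qed.

(** * Squares of large primes: union bound and Pell equations *)

(** Each 1/p^2 is at most 1/(p-1) - 1/p, which telescopes; the k rounding terms give 4 k. *)
Lemma sum_inv_sq_le N w k : 0 < w ->
  (INR (sumn [seq ((N %/ (p * p)).+1 * 4)%nat | p <- iota w.+1 k]) <=
   4 * INR N * (/ INR w - / INR (w + k)) + 4 * INR k)%R.
Proof.
move=> w0; elim: k => [|k IH]; first by rewrite /= addn0; lra.
rewrite -[in iota _ _](addn1 k) iotaD map_cat sumn_cat plus_INR [iota (w.+1 + k) 1]/= [X in (_ + INR X)%R]/= addn0.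
rewrite mult_INR S_INR [INR 4]/= (S_INR k) !addSn addnS.
move: (w + k) (leq_trans w0 (leq_addr k w)) IH => q q0 IH.
have qR : (0 < INR q)%R by apply: lt_0_INR; lia.
have qR' : (INR q.+1 = INR q + 1)%R by rewrite S_INR.
have qq : (0 < INR q.+1 * INR q.+1)%R by nra.
have H1 : (INR (N %/ (q.+1 * q.+1)) <= INR N / (INR q.+1 * INR q.+1))%R.
  apply: (Rmult_le_reg_r (INR q.+1 * INR q.+1)) => //.
  rewrite /Rdiv Rmult_assoc Rinv_l ?Rmult_1_r; last lra.
  by rewrite -!mult_INR; apply: le_INR; apply/leP; apply: leq_trunc_div.
have H2 : (INR N / (INR q.+1 * INR q.+1) <= INR N * (/ INR q - / INR q.+1))%R.
  apply: Rmult_le_compat_l; first exact: pos_INR.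
  rewrite qR'; have -> : (/ INR q - / (INR q + 1) = / ((INR q + 1) * (INR q + 1)) + / (INR q * (INR q + 1) * (INR q + 1)))%R by field; lra.
  have : (0 < / (INR q * (INR q + 1) * (INR q + 1)))%R by apply: Rinv_0_lt_compat; nra.
  by lra.
by lra.
Qed.

(* n2 e1 - n1 e2 is a positive integer, and multiplied by n2 e1 + n1 e2 >= 2 e1 e2
   it equals c (e2^2 - e1^2). *)
Lemma pell_gap k c n1 n2 e1 e2 : 0 < c <= 2 -> 1 < e1 -> 1 < e2 -> n1 < n2 ->
  n1 * n1 + c = k * (e1 * e1) -> n2 * n2 + c = k * (e2 * e2) -> 2 * (n1 * n1) <= n2 * n2.
Proof.
move=> /andP[c0 c2] he1 he2 n12 E1 E2.
(* For k = 1 two squares would differ by 1 or 2, which happens only for 0 and 1, and [e1] > 1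
   excludes this. *)
have k2 : 1 < k.
  case: k E1 {E2} => [|[|k]] // E1; first by lia.
  by case: (ltnP n1 e1) => h; nia.
have ne e n : 1 < e -> n * n + c = k * (e * e) -> e <= n by move=> *; nia.
have {ne} [m1 m2] := (ne _ _ he1 E1, ne _ _ he2 E2).
have e12 : e1 < e2.
  rewrite ltnNge; apply/negP => e21.
  have : k * (e2 * e2) <= k * (e1 * e1) by rewrite !leq_mul.
  have : n1 * n1 < n2 * n2 by rewrite ltn_mul.
  by rewrite -E1 -E2; clear; lia.
(* Cross-multiplying the two equations eliminates k. *)
have I : n1 * e2 * (n1 * e2) + c * (e2 * e2) = n2 * e1 * (n2 * e1) + c * (e1 * e1).
  have -> : n1 * e2 * (n1 * e2) + c * (e2 * e2) = (n1 * n1 + c) * (e2 * e2) by lia.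
  have -> : n2 * e1 * (n2 * e1) + c * (e1 * e1) = (n2 * n2 + c) * (e1 * e1) by lia.
  by rewrite E1 E2; lia.
have S1 : e1 * e2 <= n1 * e2 by rewrite leq_mul2r m1 orbT.
have S2 : e2 * e1 <= n2 * e1 by rewrite leq_mul2r m2 orbT.
have e11 : e1 * e1 < e2 * e2 by rewrite ltn_mul.
have ce : c * (e1 * e1) < c * (e2 * e2) by rewrite ltn_pmul2l.
have D : n1 * e2 < n2 * e1.
  rewrite ltnNge; apply/negP => h; have := leq_mul h h.
  by move: I ce; clear; lia.
have H : 2 * (e1 * e2) <= c * (e2 * e2 - e1 * e1).
  by have := leq_mul D D; rewrite mulnBr; move: I ce S1; clear; lia.
have H2 : c * (e2 * e2 - e1 * e1) <= 2 * (e2 * e2 - e1 * e1) by rewrite leq_mul2r c2 orbT.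
(* So far e1 e2 <= e2^2 - e1^2, hence e2^2 >= e1^2 + e1 e2 >= 2 e1^2; multiplication by k carries
   this over to n1 and n2. *)
have H3 : e1 * e1 <= e1 * e2 by rewrite leq_mul2l (ltnW e12) orbT.
have H4 : 2 * (e1 * e1) <= e2 * e2 by move: H H2 H3 e11; clear; lia.
have : k * (2 * (e1 * e1)) <= k * (e2 * e2) by rewrite leq_mul2l H4 orbT.
by move: E1 E2; clear; lia.
Qed.

(** The bound B only makes the search for e finite; the count of solutions below does not depend on
    it. *)
Definition pell k c B n := has (fun e => (1 < e) && (n * n + c == k * (e * e))) (iota 0 B).

(** By the gap, n^2 at least doubles from one solution to the next, so the integer part of log2(n^2)
    is injective on solutions; its values lie in [0, L]. *)
Lemma count_pell_le k c B N L : 0 < c <= 2 -> N * N <= expn 2 L ->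
  count (pell k c B) (iota 0 N) <= L.+1.
Proof.
move=> c12 NL; rewrite -size_filter -(size_map (fun n => trunc_log 2 (n * n))).
rewrite -[X in _ <= X](size_iota 0); apply: uniq_leq_size; last first.
  move=> t /mapP[n]; rewrite mem_filter mem_iota add0n => /and3P[_ _ nN] ->.
  rewrite mem_iota add0n leq0n andTb ltnS; case: n nN => [|n] nN; first by rewrite trunc_log0.
  rewrite -(@leq_exp2l 2) //; apply: leq_trans NL.
  by apply: leq_trans (trunc_logP _ _) _ => //; nia.
have inj n1 n2 : n1 < n2 -> pell k c B n1 -> pell k c B n2 ->
    trunc_log 2 (n1 * n1) < trunc_log 2 (n2 * n2).
  move=> n12 /hasP[e1 _ /andP[he1 /eqP E1]] /hasP[e2 _ /andP[he2 /eqP E2]].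
  have gap := pell_gap _ _ _ _ _ _ c12 he1 he2 n12 E1 E2.
  (* If n1 = 0, then c = k e1^2 with e1 > 1, impossible for 0 < c <= 2. Nonzero arguments are needed
     for log2(2 m) = log2(m) + 1. *)
  have n10 : 0 < n1 * n1.
    case: n1 E1 {n12 gap} => [|n1] // E1; case/andP: c12 => c0 c2.
    by case: k E1 {E2} => [|k] E1; nia.
  by rewrite -trunc_logMp //; apply: leq_trunc_log.
rewrite map_inj_in_uniq ?filter_uniq ?iota_uniq // => n1 n2.
rewrite !mem_filter => /andP[p1 _] /andP[p2 _] e.
case: (ltngtP n1 n2) => // lt; [have := inj _ _ lt p1 p2 | have := inj _ _ lt p2 p1];
by rewrite e ltnn.
Qed.

(** The primes lie in the window (w, w + B]: the second argument is a length, not an endpoint. *)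
Definition large_sq w B n :=
  has (fun p => p * p %| quart n) [seq p <- iota w.+1 B | prime p && odd p].

(** Union bound: each p excludes at most [rho p] <= 4 values of n per started period of length
    p^2. *)
Lemma count_large_sq_small w k N : 0 < w ->
  (INR (count (large_sq w k) (iota 0 N)) <= 4 * INR N / INR w + 4 * INR k)%R.
Proof.
move=> w0; have := sum_inv_sq_le N w k w0.
have wR : (0 < / INR (w + k))%R by apply/Rinv_0_lt_compat/lt_0_INR; lia.
have N0 := pos_INR N; move=> H.
apply: (Rle_trans _ (4 * INR N * (/ INR w - / INR (w + k)) + 4 * INR k)); last first.
  by have := Rmult_le_pos _ _ N0 (Rlt_le _ _ wR); lra.
apply: Rle_trans H; apply/le_INR/leP.
apply: leq_trans (count_has_le _ _ (fun p n => p * p %| quart n) _ _) _.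
elim: (iota w.+1 k) => [|p s IH] //=; case: ifP => [/andP[pp op]|_]; last first.
  by apply: leq_trans IH _; apply: leq_addl.
apply: leq_add IH; have p0 := prime_gt0 pp.
have pp0 : 0 < p * p by rewrite muln_gt0 p0.
have /andP[_] := count_periodic_bounds _ _ (dvdn_quartD (p * p)) N pp0.
by move=> H; apply: leq_trans H _; rewrite leq_mul2l rho_le4 ?orbT.
Qed.

(** Every counted n solves n^2 + c = k p^2 with k < K and c in {1, 2}; each of these 2 K equations
    has at most L + 1 solutions. *)
Lemma count_large_sq_large y B N K L : 0 < y -> N * N + 1 < K * (y * y) -> N * N <= expn 2 L ->
  count (large_sq y B) (iota 0 N) <= 2 * (K * L.+1).
Proof.
move=> y0 HK HL.
pose s := [seq (k, c) | k <- iota 0 K, c <- [:: 1; 2]].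
pose Q (u : nat * nat) n := pell u.1 u.2 (y + B).+1 n.
apply: (@leq_trans (count (fun n => has (fun u => Q u n) s) (iota 0 N))).
  rewrite -!size_filter; apply: uniq_leq_size; first by rewrite filter_uniq ?iota_uniq.
  move=> n; rewrite !mem_filter mem_iota add0n /= => /andP[/hasP[p]].
  rewrite mem_filter mem_iota => /andP[/andP[pp op] /andP[yp pB]] pd nN; rewrite nN andbT.
  have cK c : 0 < c <= 2 -> p * p %| n * n + c -> has (fun u => Q u n) s.
    move=> /andP[c0 c2] /dvdnP[k ek]; apply/hasP; exists (k, c).
      apply/allpairsP; exists (k, c); split => //=; last by rewrite !in_cons; lia.
      (* As n < N, n^2 + c <= N^2 + 1 < K y^2, whereas k >= K and p > y would give k p^2 >= K
         y^2. *)
      rewrite mem_iota /= add0n ltnNge; apply/negP => Kk.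
      have : K * (y * y) <= k * (p * p) by rewrite leq_mul // leq_mul // ltnW.
      by rewrite -ek; nia.
    apply/hasP; exists p; first by rewrite mem_iota /= add0n; lia.
    by rewrite prime_gt1 //= ek.
  by move: pd; rewrite prime_sq_dvd_quart // => /orP[]; apply: cK.
apply: leq_trans (count_has_le _ _ Q _ _) _.
have -> : 2 * (K * L.+1) = size s * L.+1 by rewrite size_allpairs size_iota /=; lia.
rewrite -(sumn_map_const _ L.+1 s); apply: leq_sumn_map => u /allpairsP[[k c] [_ cc ->]].
by apply: count_pell_le HL; move: cc => /=; rewrite !in_cons in_nil; case: eqP => [->|_] //; case: eqP => [->|].
Qed.

(** * From the Möbius function to the sieve counts *)

Definition squarefree m := all (fun p => logn p m <= 1) (primes m).

Definition squarefree_pair n := squarefree (n * n + 1) && squarefree (n * n + 2).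

Lemma squarefreePn m : 0 < m ->
  reflect (exists2 p, prime p & p * p %| m) (~~ squarefree m).
Proof.
move=> m0; apply: (iffP allPn) => [[p]|[p pp pd]].
  rewrite mem_primes -ltnNge => /and3P[pp _ _] l; exists p => //.
  by have := pfactor_dvdn 2 pp m0; rewrite l mulnn => ->.
have l : 1 < logn p m by rewrite -(pfactor_dvdn 2 pp m0) -mulnn.
by exists p; rewrite -?ltnNge // mem_primes pp m0 (dvdn_trans _ pd) ?dvdn_mulr.
Qed.

Lemma mobius_sq m : 0 < m -> (mobius m ^ 2)%Z = if squarefree m then 1%Z else 0%Z.
Proof.
rewrite /mobius /squarefree; case: m => // m _ /=.
by case: all => //; case: odd.
Qed.

Lemma squarefree_pairPn n :
  reflect (exists2 p, prime p & p * p %| quart n) (~~ squarefree_pair n).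
Proof.
rewrite /squarefree_pair negb_and; apply: (iffP orP) => [H|[p pp]].
  by case: H => /squarefreePn[|p pp pd]; try lia; exists p => //; rewrite prime_sq_dvd_quart // pd ?orbT.
rewrite prime_sq_dvd_quart // => /orP[] pd; [left|right];
by apply/squarefreePn; [lia | exists p].
Qed.

(** Squares are 0 or 1 mod 4, so 4 divides neither factor; and p >= n + 2 would give p^2 > n^2 +
    2. *)
Lemma prime_sq_dvd_quart_odd_le p n : prime p -> p * p %| quart n -> odd p && (p <= n.+1).
Proof.
move=> pp; rewrite prime_sq_dvd_quart // => H.
have [c [c1 c2 pd]] : exists c, [/\ 0 < c, c <= 2 & p * p %| n * n + c].
  by case/orP: H => pd; [exists 1 | exists 2].
apply/andP; split.
- case: (even_prime pp) => // e; move: pd; rewrite e => /dvdnP[k ek].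
  have := odd_double_half n; rewrite -muln2; move: (n./2) => q; case: (odd n) => /= eq;
  by move: ek; rewrite -eq; clear -c1 c2; nia.
- have := dvdn_leq _ pd; rewrite addn_gt0 c1 orbT => /(_ isT) le.
  by rewrite leqNgt; apply/negP => lt; have := leq_mul lt lt; lia.
Qed.

(** The count starts at n = 0, where 1 and 2 are squarefree; the subtracted 1 removes this term. *)
Lemma GammaE X : (0 < X)%R ->
  Gamma X = (INR (count squarefree_pair (iota 0 (Z.to_nat (up X)))) - 1)%R.
Proof.
move=> X0; have [u1 u2] := archimed X.
have up0 : (0 < up X)%Z by apply: lt_IZR; lra.
rewrite /Gamma; have -> : Z.to_nat (up X) = (Z.to_nat (up X) - 1).+1 by lia.
rewrite subn1 [_.+1.-1]/=; move: (Z.to_nat (up X) - 1) => k.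
have -> : count squarefree_pair (iota 0 k.+1) = (count squarefree_pair (iota 1 k)).+1 by [].
have e n : (mobius (n * n + 1) ^ 2 * mobius (n * n + 2) ^ 2)%Z =
    if squarefree_pair n then 1%Z else 0%Z.
  by rewrite !mobius_sq ?addn_gt0 ?orbT // /squarefree_pair; do 2 case: squarefree.
rewrite (eq_map e).
have -> s : foldr Z.add 0%Z [seq if squarefree_pair n then 1%Z else 0%Z | n <- s] =
    Z.of_nat (count squarefree_pair s).
  by elim: s => [|n s IH] //=; rewrite IH; case: squarefree_pair; lia.
by rewrite S_INR INR_IZR_INZ; lra.
Qed.

(** A survivor that is not a squarefree pair has a prime p > w with p^2 dividing [quart n], and p <=
    n + 1 <= N; it falls in the first window if p <= y, in the second otherwise. *)
Lemma sieve_count_squarefree N w y :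
  count squarefree_pair (iota 0 N) <= sieve_count N (odd_primes w) 1 <=
  count squarefree_pair (iota 0 N) +
    (count (large_sq w y) (iota 0 N) + count (large_sq y N.+1) (iota 0 N)).
Proof.
apply/andP; split.
  apply: sub_count => n; rewrite /= dvd1n /= => sq.
  apply/allP => p; rewrite mem_odd_primes => /and3P[pp _ _].
  by apply: contraL sq => pd; apply/squarefree_pairPn; exists p.
apply: (@leq_trans (count (predU squarefree_pair (predU (large_sq w y) (large_sq y N.+1))) (iota 0 N))).
  rewrite /sieve_count -!size_filter; apply: uniq_leq_size; first by rewrite filter_uniq ?iota_uniq.
  move=> n; rewrite !mem_filter mem_iota add0n => /andP[/andP[_ sv] /= nN].
  rewrite nN andbT; case sq: (squarefree_pair n) => //=.
  have /squarefree_pairPn[p pp pd] := negbT sq.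
  have /andP[op pn] := prime_sq_dvd_quart_odd_le p n pp pd.
  have [pw|wp] := leqP p w.
    by move/allP: sv => /(_ p); rewrite mem_odd_primes pp op pw pd => /(_ isT).
  have [py|yp] := leqP p y; apply/orP; [left|right]; apply/hasP; exists p => //;
  by rewrite mem_filter pp op mem_iota /=; lia.
by rewrite -count_predUI addnA -count_predUI -addnA leq_addr.
Qed.

(** * Choice of parameters as powers of U, and the final estimate *)

Lemma INR_expn m k : INR (expn m k) = (INR m ^ k)%R.
Proof. by elim: k => [|k IH] //; rewrite expnS mult_INR IH. Qed.

Lemma sqrt_pow2M x k : (0 <= x)%R -> sqrt (x ^ (k + k)) = (x ^ k)%R.
Proof. by move=> x0; rewrite pow_add sqrt_square //; apply: pow_le. Qed.

(** The union bound gives 4 U^16 + 4 U^16, and the Pell equations 4 U^4 (36 U + 1) <= 148 U^16,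
    hence 156. *)
Lemma count_large_sq_le U N : 1 < U -> N <= expn U 18 ->
  (INR (count (large_sq (expn U 2) (expn U 16)) (iota 0 N) +
        count (large_sq (expn U 16) N.+1) (iota 0 N)) <= 156 * INR U ^ 16)%R.
Proof.
move=> U1 NU; have u1 : (1 <= INR U)%R by apply: (le_INR 1); lia.
have NR : (INR N <= INR U ^ 18)%R by rewrite -INR_expn; apply/le_INR/leP.
have U0 k : 0 < expn U k by rewrite expn_gt0 ltnW.
have NN : N * N <= expn U 36 by rewrite -[36]/(18 + 18) expnD leq_mul.
have HK : N * N + 1 < 2 * expn U 4 * (expn U 16 * expn U 16).
  have -> : 2 * expn U 4 * (expn U 16 * expn U 16) = 2 * expn U 36 by rewrite -mulnA -!expnD.
  have : 1 < expn U 36 by rewrite -{1}(expn0 U) ltn_exp2l.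
  by move: (expn U 36) NN; clear; lia.
(* The crude U < 2^U replaces the logarithm by 36 U, leaving a term of order U^5 only. *)
have HL : N * N <= expn 2 (U * 36).
  by rewrite expnM; apply: leq_trans NN _; rewrite leq_exp2r // ltnW // ltn_expl.
have A := count_large_sq_small (expn U 2) (expn U 16) N (U0 2).
have B := count_large_sq_large (expn U 16) N.+1 N _ _ (U0 16) HK HL.
move/leP/le_INR: B; rewrite (mult_INR 2 (_ * _)) (mult_INR (2 * _)) (mult_INR 2) (S_INR (U * 36)) (mult_INR U 36) INR_expn [INR 2]/=.
have -> : INR 36 = 36%R by rewrite INR_IZR_INZ.
move=> B; rewrite plus_INR; rewrite !INR_expn in A.
move: (count _ _) (count _ _) A B => a b A B.
have P5 : (INR U ^ 5 <= INR U ^ 16)%R by apply: Rle_pow => //; lia.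
have P4 : (INR U ^ 4 <= INR U ^ 16)%R by apply: Rle_pow => //; lia.
have Q : (4 * INR N / INR U ^ 2 <= 4 * INR U ^ 16)%R.
  have -> : (4 * INR U ^ 16 = 4 * INR U ^ 18 / INR U ^ 2)%R by field; lra.
  apply: Rmult_le_compat_r; last lra.
  by left; apply/Rinv_0_lt_compat/pow_lt; lra.
have e : (INR U ^ 5 = INR U ^ 4 * INR U)%R by ring.
by nra.
Qed.

(** The sieve error is at most (U^14 + U^15) exp 8, hence 2 exp 8 U^16; the constant 160 is 156 for
    the large primes plus 4 for the tail of the Euler product. *)
Lemma squarefree_pair_count_approx s :
  (forall M, 0 < M -> (s <= sigma_partial M <= s + 4 / INR M)%R) ->
  forall U N, 1 < U -> N <= expn U 18 ->
  (Rabs (INR (count squarefree_pair (iota 0 N)) - s * INR N) <=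
     (160 + 2 * exp 8) * INR U ^ 16)%R.
Proof.
move=> Hs U N U1 NU; have u1 : (1 <= INR U)%R by apply: (le_INR 1); lia.
have NR : (INR N <= INR U ^ 18)%R by rewrite -INR_expn; apply/le_INR/leP.
have N0 := pos_INR N.
have w0 : 0 < expn U 2 by rewrite expn_gt0 ltnW.
set w := expn U 2 in w0.
have wR : INR w = (INR U ^ 2)%R by rewrite INR_expn.
have up k : (1 <= INR U ^ k)%R by rewrite -[X in (X <= _)%R](pow1 k); apply: pow_incr; lra.
have main : (Rabs (INR (sieve_count N (odd_primes w) 1) - INR N * sigma_partial w) <= 2 * exp 8 * INR U ^ 16)%R.
  have D1 : sq_density 1 = 1%R by rewrite /sq_density rho1 /=; field.
  have R1 : rankin 1 = 1%R by rewrite /rankin rho1 /= sqrt_1; field.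
  (* The choice is z = U^8, w = U^2 and D = z w = U^10, so that sqrt z = U^4 and D sqrt D = U^15. *)
  have := sieve_count_approx N (INR U ^ 8) (INR U ^ 2) (INR U ^ 10) (odd_primes w) 1.
  rewrite D1 R1 sigma_partialE !Rmult_1_r (sqrt_pow2M (INR U) 4) ?(sqrt_pow2M (INR U) 5); try lra.
  move=> H; apply: Rle_trans (H _ _ _ _ _ _ _) _ => //.
  - by apply: pow_lt; lra.
  - by right; ring.
  - move=> p; rewrite mem_odd_primes => /and3P[pp op pw]; split => //.
    by rewrite -wR; apply/le_INR/leP.
  - by rewrite filter_uniq // iota_uniq.
  - by move=> p _; rewrite coprime1n.
  have K0 : (1 <= rankin_prod (odd_primes w))%R.
    by apply: rankin_prod_ge1; apply/allP => q; rewrite mem_odd_primes => /and3P[/prime_gt0].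
  have K1 : (rankin_prod (odd_primes w) <= exp 8)%R.
    apply: Rle_trans (rankin_prod_le _ w0) _; apply/Rlt_le/exp_increasing.
    have : (0 < 8 / sqrt (INR w))%R.
      by apply: Rmult_lt_0_compat; [lra | apply/Rinv_0_lt_compat/sqrt_lt_R0/lt_0_INR; lia].
    by lra.
  have E1 : (INR N / INR U ^ 4 <= INR U ^ 16)%R.
    apply: (Rle_trans _ (INR U ^ 18 / INR U ^ 4)).
      by apply: Rmult_le_compat_r => //; left; apply/Rinv_0_lt_compat/pow_lt; lra.
    have -> : (INR U ^ 18 / INR U ^ 4 = INR U ^ 14)%R by field; lra.
    by apply: Rle_pow => //; lia.
  have E2 : (INR U ^ 10 * INR U ^ 5 <= INR U ^ 16)%R.
    by rewrite -pow_add; apply: Rle_pow => //; lia.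
  have := up 16; have := up 10; have := up 5 => *.
  rewrite (Rmult_comm (2 * exp 8)) -Rmult_assoc.
  apply: Rmult_le_compat; [ | lra | lra | lra].
  have : (0 <= INR N / INR U ^ 4)%R.
    by apply: Rmult_le_pos => //; left; apply/Rinv_0_lt_compat/pow_lt; lra.
  by nra.
have sig : (0 <= INR N * (sigma_partial w - s) <= 4 * INR U ^ 16)%R.
  have [s1 s2] := Hs w w0; split; first by apply: Rmult_le_pos; lra.
  apply: (Rle_trans _ (INR U ^ 18 * (4 / INR w))).
    by apply: Rmult_le_compat; lra.
  by rewrite wR; right; field; lra.
have /andP[/leP/le_INR c1 /leP/le_INR] := sieve_count_squarefree N w (expn U 16).
rewrite plus_INR => c2; have := count_large_sq_le U N U1 NU; rewrite -/w => c3.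
have [m1 m2] := Rabs_le_inv _ _ main; have up16 := up 16.
by apply: Rabs_le; split; lra.
Qed.

Theorem theorem1 :
  exists sigma : R,
    Un_cv sigma_partial sigma /\
    forall eps : R, (0 < eps)%R ->
      exists C X0 : R, (0 < X0)%R /\
        forall X : R, (X0 <= X)%R ->
          (Rabs (Gamma X - sigma * X) <= C * Rpower X (8 / 9 + eps))%R.
Proof.
have [s cvs Hs] := sigma_partial_cv; exists s; split => // eps eps0.
(* A negative limit would contradict the nonnegativity of the partial products. *)
have s1 : (0 <= s <= 1)%R.
  have := Hs 1 isT; have := sigma_partial_itv 1 => a [b _]; split; last lra.
  apply: Rnot_lt_le => neg; have [n Hn] := cvs (- s)%R ltac:(lra).
  have := Hn n ltac:(lia); rewrite /Rdist => /Rabs_def2[h _].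
  by have := sigma_partial_itv n; lra.
(* The factor 2^16 comes from U <= x + 1 <= 2 x with x = X^(1/18); the 2 absorbs the term n = 0 and
   the rounding s (N - X), which lies in [0, 1]. *)
exists ((160 + 2 * exp 8) * 2 ^ 16 + 2)%R, 2%R; split; first lra.
move=> X X2.
set x := Rpower X (/ 18).
have x1 : (1 < x)%R.
  rewrite -(Rpower_O X); last lra.
  by apply: Rpower_lt; lra.
have x18 : (x ^ 18 = X)%R.
  rewrite -Rpower_pow; last lra.
  by rewrite /x Rpower_mult INR_IZR_INZ /= Rinv_l ?Rpower_1; lra.
have x16 : (x ^ 16 <= Rpower X (8 / 9 + eps))%R.
  rewrite -Rpower_pow; last lra.
  by rewrite /x Rpower_mult INR_IZR_INZ /=; apply: Rle_Rpower; lra.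
have [u1 u2] := archimed x; have [v1 v2] := archimed X.
have up0 : (0 < up x)%Z by apply: lt_IZR; lra.
have upX0 : (0 < up X)%Z by apply: lt_IZR; lra.
set U := Z.to_nat (up x); set N := Z.to_nat (up X).
have UR : INR U = IZR (up x) by rewrite INR_IZR_INZ Z2Nat.id //; lia.
have NR : INR N = IZR (up X) by rewrite INR_IZR_INZ Z2Nat.id //; lia.
have U1 : 1 < U by apply/ltP/INR_lt; rewrite UR /=; lra.
(* N - 1 <= X = x^18 < U^18, and both ends are integers. *)
have NU : N <= expn U 18.
  rewrite -ltnS; apply/ltP/INR_lt; rewrite NR S_INR INR_expn UR.
  have lt : (x ^ 18 < IZR (up x) ^ 18)%R.
    by rewrite -!Rpower_pow; [apply: Rlt_Rpower_l; [apply: lt_0_INR; lia | lra] | lra | lra].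
  by rewrite x18 in lt; lra.
have A := squarefree_pair_count_approx s Hs U N U1 NU.
have up16 : (INR U ^ 16 <= 2 ^ 16 * x ^ 16)%R.
  by rewrite -Rpow_mult_distr; apply: pow_incr; lra.
have x16' : (1 <= x ^ 16)%R by rewrite -[X in (X <= _)%R](pow1 16); apply: pow_incr; lra.
have e0 := exp_pos 8.
rewrite GammaE -/N; last lra.
have [a1 a2] := Rabs_le_inv _ _ A.
have b : (0 <= s * (INR N - X) <= 1)%R by rewrite NR; nra.
have c : ((160 + 2 * exp 8) * INR U ^ 16 <= (160 + 2 * exp 8) * 2 ^ 16 * x ^ 16)%R.
  by rewrite Rmult_assoc; apply: Rmult_le_compat_l; lra.
have d : (((160 + 2 * exp 8) * 2 ^ 16 + 2) * x ^ 16 <= ((160 + 2 * exp 8) * 2 ^ 16 + 2) * Rpower X (8 / 9 + eps))%R.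
  by apply: Rmult_le_compat_l; lra.
by apply: Rle_trans d; apply: Rabs_le; split; lra.
Qed.
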